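(* Let $G$ be a finite simple graph with maximum degree $\Delta=\Delta(G)\ge 1$. If $z\in\mathbb{C}$ is a root of the domination polynomial $D(G,x)$, then $|z|<e(\Delta+1)$.
   Context: A set $S\subseteq V(G)$ is dominating if every vertex of $G$ is in $S$ or adjacent to a vertex of $S$. For a graph $G$ on $n$ vertices, $d_k(G)$ is the number of dominating sets of size $k$, and the domination polynomial is $D(G,x)=\sum_{k=0}^n d_k(G)x^k$. *)

(* Defs.v *)
From mathcomp Require Import all_boot all_order all_algebra.

Set Implicit Arguments.
Unset Strict Implicit.
Unset Printing Implicit Defensive.

Import GRing.Theory.
Local Open Scope ring_scope.

Record sgraph := SGraph {
  vertex :> finType;
  adj : rel vertex;
  adj_sym : symmetric adj;
  adj_irrefl : irreflexive adj }.

Definition degree (G : sgraph) (v : G) : nat := #|[set w : G | adj v w]|.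

Definition max_degree (G : sgraph) : nat := (\max_(v : G) degree v)%N.

Definition dominating (G : sgraph) (S : {set G}) : bool :=
  [forall v : G, (v \in S) || [exists w in S, adj v w]].

Definition num_dominating (G : sgraph) (k : nat) : nat :=
  #|[set S : {set G} | dominating S & #|S| == k]|.

(* The coefficients are natural numbers, so the polynomial is defined over an
   arbitrary ring R; its complex roots are those of the instance at R[i]. *)
Definition domination_poly (R : nzRingType) (G : sgraph) : {poly R} :=
  \sum_(0 <= k < #|G|.+1) (num_dominating G k)%:R *: 'X^k.

(* Main.v *)
(** Passing to complements, [z^-n * D(G, z)] is the independence polynomial at
    [w = 1/z] of the hypergraph of closed neighbourhoods, in which every vertex
    lies in at most [Delta + 1] hyperedges. For a vertex [u] this polynomial
    satisfies [Z H = Z (H - u) + w * Z (H / u)], where [H / u] is [H - u]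
    together with the edges through [u], shrunk by [u]. Adding back the shrunk
    edges one at a time, each of them multiplies [Z] by at most [1 / (1 - r)]
    in norm with [r = 1 / (Delta + 1)], because the vertices of an edge that is
    still missing have degree at most [Delta]. As [e (Delta + 1) <= `|z|] gives
    [`|w| < r (1 - r) ^ Delta], the second term is always dominated by the
    first, and [Z] does not vanish. *)
Require Import Defs.
From mathcomp Require Import all_boot all_order all_algebra.
From mathcomp Require Import reals sequences exp.
From mathcomp Require Import complex.

Set Implicit Arguments.
Unset Strict Implicit.
Unset Printing Implicit Defensive.

Import Order.TTheory GRing.Theory Num.Theory.
Local Open Scope ring_scope.
Local Open Scope complex_scope.

(** * Independence sums of hypergraphs and their vertex recursion *)

Section HypergraphIndependencePolynomial.

Variables (C : numFieldType) (T : finType).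
Implicit Types (V S f : {set T}) (E F : seq {set T}) (u v : T).

Definition independent E S : bool := all (fun e : {set T} => ~~ (e \subset S)) E.

(* Hyperedges not contained in the vertex set [V] impose no constraint. *)
Definition indep_sum (w : C) V E : C :=
  \sum_(S : {set T} | (S \subset V) && independent E S) w ^+ #|S|.

Definition hdeg E u : nat := count (fun e : {set T} => u \in e) E.

Definition del_edges u E := [seq e : {set T} <- E | u \notin e].

(** Shrinking can make two edges coincide; keeping edges in a sequence, with multiplicity, leaves
    the degrees of the other vertices unchanged. *)
Definition contract u E := [seq e :\ u | e : {set T} <- E].

Lemma indep_sum_perm w V E F :
  perm_eq E F -> indep_sum w V E = indep_sum w V F.
Proof.
by move=> EF; apply: eq_bigl => S; rewrite /independent (perm_all _ EF).
Qed.

Lemma hdeg_contract u v E : v != u -> hdeg (contract u E) v = hdeg E v.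
Proof.
move=> vu; rewrite /hdeg count_map; apply: eq_count => e /=.
by rewrite in_setD1 vu.
Qed.

(** Split by whether [u \in S]: an edge [e] lies in [u |: S] exactly when [e :\ u] lies in [S]. *)
Lemma indep_sum_vertex w V E u : u \in V ->
  indep_sum w V E = indep_sum w (V :\ u) (del_edges u E)
                    + w * indep_sum w (V :\ u) (contract u E).
Proof.
move=> uV; rewrite /indep_sum (bigID (fun S => u \in S)) /= addrC.
congr (_ + _).
  apply: eq_bigl => S; rewrite subsetD1 -!andbA.
  case: (boolP (S \subset V)) => //= _; rewrite andbC.
  case: (boolP (u \in S)) => //= uS.
  rewrite /independent all_filter; apply: eq_all => e /=.
  case: (boolP (u \in e)) => //= ue.
  by apply/negP => /subsetP/(_ u ue); rewrite (negPf uS).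
rewrite big_distrr /=.
rewrite (reindex_onto (fun S => u |: S) (fun S => S :\ u)) /=; last first.
  by move=> S /andP[_ uS]; rewrite setD1K.
apply: eq_big => [S|S].
  rewrite setU11 andbT subsetD1.
  have -> : ((u |: S) :\ u == S) = (u \notin S).
    apply/eqP/idP => [<-|uS]; first by rewrite !inE eqxx.
    by rewrite setU1K.
  case: (boolP (u \in S)) => /= uS; rewrite ?andbF ?andbT //=.
  rewrite subUset sub1set uV /=; congr (_ && _).
  rewrite /independent all_map; apply: eq_all => e /=.
  by rewrite subDset.
move=> /andP[_ /eqP SE]; rewrite cardsU1.
have -> : u \notin S by rewrite -SE !inE eqxx.
by rewrite add1n exprS.
Qed.

Lemma indep_sum_empty_edge w V E : indep_sum w V (set0 :: E) = 0.
Proof.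
by rewrite /indep_sum big1 // => S; rewrite /independent /= sub0set andbF.
Qed.

Lemma indep_sum_outer_edge w V E f : ~~ (f \subset V) ->
  indep_sum w V (f :: E) = indep_sum w V E.
Proof.
move=> fV; apply: eq_bigl => S; rewrite /independent /=.
case: (boolP (S \subset V)) => //= SV.
suff -> : ~~ (f \subset S) by [].
by apply: contra fV => /subset_trans; apply.
Qed.

Lemma indep_sum_set0 w E : set0 \notin E -> indep_sum w set0 E = 1.
Proof.
move=> E0; rewrite /indep_sum (bigD1 set0) /=; last first.
  rewrite sub0set /=; apply/allP => e eE; rewrite subset0.
  by apply: contraNneq E0 => <-.
rewrite cards0 big1 ?addr0 // => S /andP[/andP[]].
by rewrite subset0 => ->.
Qed.

(** * The effect of a single edge, and non-vanishing *)

Section EdgeBounds.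

Variables (w r : C) (D : nat).
Hypotheses (r0 : 0 <= r) (rh : r <= 1 - r) (wr : `|w| <= r * (1 - r) ^+ D).

Local Notation q := (1 - r).
Local Notation Z := (indep_sum w).

Let q0 : 0 <= q. Proof. exact: le_trans rh. Qed.
Let q1 : q <= 1. Proof. by rewrite gerBl. Qed.

(** Named so that [indep_sum_contract_le] can be applied both inside the induction of [edge_bounds]
    and after it. *)
Definition edge_bound V := forall E f,
  {in V, forall v, hdeg (f :: E) v <= D.+1}%N ->
  q * `|Z V (f :: E)| <= `|Z V E|.

Lemma indep_sum_contract_le V u E : u \notin V -> edge_bound V ->
  {in V, forall v, hdeg E v <= D.+1}%N ->
  q ^+ hdeg E u * `|Z V (contract u E)| <= `|Z V (del_edges u E)|.
Proof.
move=> uV Vle Edeg.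
(* [F] collects the processed edges avoiding [u], which both operations keep; each edge through [u]
   costs one factor [q]. *)
suff gen E1 F : {in V, forall v, hdeg E1 v + hdeg F v <= D.+1}%N ->
    q ^+ hdeg E1 u * `|Z V (contract u E1 ++ F)|
      <= `|Z V (del_edges u E1 ++ F)|.
  have := gen E [::]; rewrite !cats0; apply=> v vV.
  by rewrite addn0; exact: Edeg.
elim: E1 F => [|e E1 IH] F EF /=; first by rewrite mul1r.
case: (boolP (u \in e)) => ue /=.
  rewrite exprS -mulrA mulrCA.
  have EF' : {in V, forall v, hdeg E1 v + hdeg F v <= D.+1}%N.
    move=> v vV; apply: leq_trans (EF v vV).
    by rewrite leq_add2r /= leq_addl.
  apply: le_trans (IH F EF'); rewrite ler_wpM2l ?exprn_ge0 //.
  apply: Vle => v vV; apply: leq_trans (EF v vV).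
  have vu : v != u by apply: contraNneq uV => <-.
  rewrite /hdeg /= count_cat addnA.
  by rewrite [count _ (contract _ _)]hdeg_contract // in_setD1 vu.
have -> : e :\ u = e by apply/setP => x; rewrite !inE; case: eqP => // ->;
  rewrite (negPf ue).
rewrite add0n.
rewrite (indep_sum_perm w V (permEl (perm_catCA [:: e] (contract u E1) F))).
rewrite (indep_sum_perm w V (permEl (perm_catCA [:: e] (del_edges u E1) F))).
apply: IH => v vV; apply: leq_trans (EF v vV).
by rewrite /hdeg /= addnCA addnA.
Qed.

(** Expand both sums at a vertex [u] of [f]: the deletion terms agree, so only the contraction terms
    differ. On the smaller vertex set the first bound controls that difference and the second
    compares contraction with deletion, so both go through one induction. *)
Lemma edge_bounds V E f :
  {in V, forall v, hdeg (f :: E) v <= D.+1}%N ->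
  `|Z V E - Z V (f :: E)| <= `|Z V E| /\ q * `|Z V (f :: E)| <= `|Z V E|.
Proof.
have [n] := ubnP #|V|; elim: n V E f => // n IH V E f Vn fE.
have [fV|] := boolP (f \subset V); last first.
  move=> fV; rewrite indep_sum_outer_edge // subrr normr0.
  by split=> //; rewrite ler_piMl.
have [->|[u uf]] := set_0Vmem f.
  by rewrite indep_sum_empty_edge subr0 normr0 mulr0.
have uV := subsetP fV u uf.
have Vun : (#|V :\ u| < n)%N by rewrite (cardsD1 u) uV in Vn.
have sub v : v \in V :\ u -> v != u /\ v \in V by rewrite in_setD1 => /andP.
have IHb : edge_bound (V :\ u) by move=> E' f' d'; have [] := IH _ E' f' Vun d'.
rewrite !(indep_sum_vertex w _ uV) /= uf /=.
set a := Z _ (del_edges u E); set b := Z _ (contract u E).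
set c := Z _ (f :\ u :: contract u E).
have bc : `|b - c| <= `|b|.
  have [v /sub[vu vV]|//] := IH (V :\ u) (contract u E) (f :\ u) Vun.
  apply: leq_trans (fE v vV).
  by rewrite /= in_setD1 vu -/(hdeg (contract u E) v) hdeg_contract.
(* As [f] itself contains [u], at most [D] edges of [E] do; hence the exponent [D] in [wr]. *)
have wb : `|w| * `|b| <= r * `|a|.
  apply: (@le_trans _ _ (r * (q ^+ hdeg E u * `|b|))).
    rewrite mulrA ler_wpM2r //; apply: le_trans wr _.
    rewrite ler_wpM2l // ler_wiXn2l //.
    by have := fE u uV; rewrite /= uf.
  rewrite ler_wpM2l // indep_sum_contract_le ?setD11 // => v /sub[_ vV].
  by apply: leq_trans (fE v vV); rewrite /= leq_addl.
have qa : q * `|a| <= `|a + w * b|.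
  rewrite mulrBl mul1r lerBlDr.
  apply: (@le_trans _ _ (`|a + w * b| + `|w * b|)).
    by have := ler_normB (a + w * b) (w * b); rewrite addrK.
  by rewrite lerD2l normrM.
have wbc : `|w * (b - c)| <= r * `|a|.
  by rewrite normrM; apply: le_trans wb; rewrite ler_wpM2l.
split.
  rewrite opprD addrACA subrr add0r -mulrBr.
  by apply: le_trans wbc (le_trans _ qa); rewrite ler_wpM2r.
have -> : a + w * c = (a + w * b) - w * (b - c).
  by rewrite mulrBr opprB addrACA subrr addr0.
(* The error [q * r] times the norm of [a] is, by [qa], at most [r] times that of [a + w * b], and
   [q + r = 1]. *)
apply: (@le_trans _ _ (q * (`|a + w * b| + r * `|a|))).
  by rewrite ler_wpM2l //; apply: le_trans (ler_normB _ _) _; rewrite lerD2l.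
rewrite mulrDr mulrCA.
apply: (@le_trans _ _ (q * `|a + w * b| + r * `|a + w * b|)).
  by rewrite lerD2l ler_wpM2l.
by rewrite -mulrDl subrK mul1r.
Qed.

(** With no edge set aside, [u] may have full degree [D.+1]; the bound [q ^+ D.+1] on [w] still
    makes the contraction term strictly smaller than the deletion term, nonzero by induction. *)
Lemma indep_sum_neq0 V E : `|w| < q ^+ D.+1 -> set0 \notin E ->
  {in V, forall v, hdeg E v <= D.+1}%N -> Z V E != 0.
Proof.
move=> wq; have [n] := ubnP #|V|; elim: n V E => // n IH V E Vn E0 Edeg.
have [->|[u uV]] := set_0Vmem V; first by rewrite indep_sum_set0 ?oner_eq0.
have Edeg' : {in V :\ u, forall v, hdeg E v <= D.+1}%N.
  by move=> v; rewrite in_setD1 => /andP[_]; exact: Edeg.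
have a0 : Z (V :\ u) (del_edges u E) != 0.
  apply: IH; first by rewrite (cardsD1 u) uV in Vn.
    by rewrite mem_filter negb_and E0 orbT.
  move=> v /Edeg'; apply: leq_trans.
  by rewrite /hdeg count_filter; apply: sub_count => e /andP[].
rewrite (indep_sum_vertex w _ uV).
have ba : q ^+ D.+1 * `|Z (V :\ u) (contract u E)|
    <= `|Z (V :\ u) (del_edges u E)|.
  have Vle : edge_bound (V :\ u) by move=> E' f' /edge_bounds[].
  apply: le_trans (indep_sum_contract_le _ Vle Edeg'); last by rewrite setD11.
  by rewrite ler_wpM2r // ler_wiXn2l // Edeg.
rewrite addr_eq0; apply/eqP => /(congr1 Num.norm); rewrite normrN normrM => ab.
have [b0|b0] := eqVneq (Z (V :\ u) (contract u E)) 0.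
  by move/eqP: ab; rewrite b0 normr0 mulr0 normr_eq0 (negPf a0).
by move: ba; rewrite ab ler_pM2r ?normr_gt0 // => /(lt_le_trans wq); rewrite ltxx.
Qed.

End EdgeBounds.

End HypergraphIndependencePolynomial.

(** * Dominating sets as complements of independent sets *)

Definition closed_nbhds (G : sgraph) : seq {set G} :=
  [seq [set w | (w == v) || adj v w] | v <- enum G].

Lemma independent_closed_nbhds (G : sgraph) (S : {set G}) :
  independent (closed_nbhds G) (~: S) = dominating S.
Proof.
rewrite /independent all_map; apply/allP/forallP => /= [h v|h v _] /=.
  have /subsetPn[x] := h v (mem_enum _ v).
  rewrite !inE negbK => /orP[/eqP->->//|vx xS].
  by apply/orP; right; apply/existsP; exists x; rewrite xS.
apply/subsetPn; case/orP: (h v) => [vS|/existsP[x /andP[xS vx]]].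
  by exists v; rewrite !inE ?eqxx ?negbK.
by exists x; rewrite !inE ?vx ?orbT ?negbK.
Qed.

(** By symmetry of [adj], the centres of the closed neighbourhoods containing [v] are [v] and its
    neighbours. *)
Lemma hdeg_closed_nbhds (G : sgraph) (v : G) :
  (hdeg (closed_nbhds G) v <= (max_degree G).+1)%N.
Proof.
rewrite /hdeg count_map -size_filter.
have -> : size [seq x <- enum G | v \in [set w | (w == x) || adj x w]]
          = #|v |: [set w | adj v w]|.
  rewrite cardE /enum_mem -filter_predI; congr size; apply: eq_filter => x /=.
  by rewrite !inE eq_sym adj_sym andbT.
rewrite cardsU1 -add1n leq_add ?leq_b1 //.
exact: (leq_bigmax v).
Qed.

Lemma horner_domination_poly (C : numFieldType) (G : sgraph) (z : C) :
  (domination_poly C G).[z] = \sum_(S : {set G} | dominating S) z ^+ #|S|.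
Proof.
rewrite /domination_poly horner_sum big_mkord.
rewrite (partition_big (fun S : {set G} => inord #|S| : 'I_#|G|.+1) predT) //=.
apply: eq_bigr => k _; rewrite hornerZ hornerXn /num_dominating.
rewrite -sumr_const mulr_suml; apply: eq_big => [S|S].
  rewrite !inE; congr (_ && _).
  by rewrite -val_eqE /= inordK // ltnS max_card.
by rewrite inE mul1r => /andP[_ /eqP->].
Qed.

Lemma horner_domination_poly_indep (C : numFieldType) (G : sgraph) (z : C) :
  z != 0 -> (domination_poly C G).[z]
            = z ^+ #|G| * indep_sum z^-1 setT (closed_nbhds G).
Proof.
move=> z0; rewrite horner_domination_poly /indep_sum big_distrr /=.
rewrite (reindex_inj (can_inj (@setCK G))) /=.
apply: eq_big => [S|S _]; first by rewrite subsetT -independent_closed_nbhds setCK.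
have SG : (#|S| <= #|G|)%N by exact: max_card.
by rewrite cardsCs setCK exprVn -expfB_cond ?(negPf z0).
Qed.

(** Since 1 - 1/(D+1) = 1/(1 + 1/D), this amounts to (1 + 1/D)^D < e, which follows from 1 + x < exp
    x at x = 1/D. *)
Lemma expR1V_lt (R : realType) (D : nat) : (0 < D)%N ->
  (expR 1)^-1 < (1 - D.+1%:R^-1 : R) ^+ D.
Proof.
move=> D0; have D0' : 0 < D%:R :> R by rewrite ltr0n.
have qE : 1 - D.+1%:R^-1 = (1 + D%:R^-1)^-1 :> R.
  have p0 : 1 + D%:R^-1 != 0 :> R.
    by rewrite gt_eqF // addr_gt0 // invr_gt0.
  have DE : D.+1%:R = D%:R * (1 + D%:R^-1) :> R.
    by rewrite mulrDr mulr1 mulfV ?natr1 // gt_eqF.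
  apply: (mulIf (x := D.+1%:R)); first by rewrite pnatr_eq0.
  rewrite mulrBl mul1r mulVf ?pnatr_eq0 // -[in LHS]natr1 addrK.
  by rewrite DE mulrCA mulVf // mulr1.
rewrite qE exprVn ltf_pV2 ?posrE ?expR_gt0 //; last first.
  by rewrite exprn_gt0 // addr_gt0 // invr_gt0.
rewrite -[X in expR X](mulfV (lt0r_neq0 D0')) mulrC expRM_natr.
rewrite ltrXn2r -?lt0n ?expR_ge0 ?addr_ge0 ?invr_ge0 ?ltW //.
by rewrite expR_gt1Dx // gt_eqF // invr_gt0.
Qed.

Theorem theorem5 (R : realType) (G : sgraph) (hG : (1 <= max_degree G)%N)
    (z : R[i]) (hz : root (domination_poly R[i] G) z) :
  `|z| < (expR 1 * (max_degree G + 1)%:R)%:C.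
Proof.
set D := max_degree G in hG *; rewrite addn1.
have e0 : 0 < expR 1 * D.+1%:R :> R by rewrite mulr_gt0 ?expR_gt0 ?ltr0n.
(* The order on [R[i]] is partial; the negation is legitimate because both sides are real. *)
rewrite real_ltNge ?normr_real ?complex_real //; apply/negP => zle.
have e0C : 0 < (expR 1 * D.+1%:R)%:C :> R[i] by rewrite ltcR.
have z0 : z != 0 by rewrite -normr_gt0 (lt_le_trans e0C).
move: hz; rewrite rootE horner_domination_poly_indep // mulf_eq0.
rewrite expf_eq0 (negPf z0) andbF /=; apply/negP.
pose r : R := D.+1%:R^-1.
have r0 : 0 < r by rewrite invr_gt0 ltr0n.
(* As the maximum degree is at least 1, r is at most 1/2. *)
have rh : r <= 1 - r.
  rewrite lerBrDr -mulr2n -mulr_natl ler_pdivrMr ?ltr0n // mul1r ler_nat.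
  by rewrite ltnS.
(* The norm of 1/z is at most 1/(e(D+1)) = r/e, and 1/e < (1 - r)^D. *)
have wlt : `|z^-1| < (r * (1 - r) ^+ D)%:C.
  rewrite normfV.
  apply: (@le_lt_trans _ _ ((expR 1 * D.+1%:R)%:C^-1)).
    by rewrite lef_pV2 ?posrE ?normr_gt0.
  by rewrite -fmorphV /= ltcR invfM mulrC ltr_pM2l // expR1V_lt.
have qC : (1 - r)%:C = 1 - r%:C by rewrite rmorphB rmorph1.
apply: (@indep_sum_neq0 _ _ _ r%:C D).
- by rewrite lecR ltW.
- by rewrite -qC lecR.
- by rewrite -qC -rmorphXn -rmorphM ltW.
(* By [rh] the factor [r] can be traded for one more factor [1 - r]. *)
- apply: lt_le_trans wlt _; rewrite -qC -rmorphXn lecR exprS.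
  by rewrite ler_wpM2r // exprn_ge0 // (le_trans (ltW r0)).
- apply/mapP => -[v _ /setP/(_ v)]; by rewrite !inE eqxx.
- by move=> v _; exact: hdeg_closed_nbhds.
Qed.
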